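(* Let $\gamma=\mathcal{N}(0,I_d)$ and $H=\mathbb{E}_{\mathbf{x}\sim\gamma}\big[\mathbf{x}\,(\nabla\log p(\mathbf{x})+\mathbf{x})^\top\big]$. For every orthogonal matrix $R\in\mathbb{R}^{d\times d}$, $$\tilde I(\gamma,p_R)\ \ge\ \sum_{i=1}^d\big(RHR^\top\big)_{ii}^2.$$ Moreover, equality holds if $p=\mathcal{N}(0,\Sigma)$ for a positive definite $\Sigma$; in that case $H=I_d-\Sigma^{-1}$.
   Context: Standing assumptions: $p$ is a positive, continuously differentiable probability density on $\mathbb{R}^d$ with $|\log p(\mathbf{x})|\le c(1+\|\mathbf{x}\|_2^m)$ and $\|\nabla\log p(\mathbf{x})\|_2\le c(1+\|\mathbf{x}\|_2^m)$ for some $c>0,m\ge2$. For orthogonal $R$, $p_R(\mathbf{x})=p(R^\top\mathbf{x})$ is the density of $RX$, $X\sim p$. For a product density $q$, $\mathbb{E}_{q_{-i}}[f(\mathbf{x})]$ denotes the expectation over all coordinates other than $x_i$ under $q$ (a function of $x_i$), and the projected Fisher information is $\tilde I(q,p)=\sum_{i=1}^d \mathbb{E}_{q}\big[\big(\mathbb{E}_{q_{-i}}[\partial_i\log q(\mathbf{x})-\partial_i\log p(\mathbf{x})]\big)^2\big]$. *)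

(* Defs.v *)
From HB Require Import structures.
From mathcomp Require Import all_boot all_order all_algebra.
From mathcomp Require Import all_classical all_reals all_analysis.
From mathcomp Require Import normal_distribution.

Set Implicit Arguments.
Unset Strict Implicit.
Unset Printing Implicit Defensive.

Import Order.TTheory GRing.Theory Num.Theory.
Import numFieldNormedType.Exports.

Local Open Scope classical_set_scope.
Local Open Scope ring_scope.

Section Defs.
Variables (R : realType) (d : nat).

Definition norm2 (x : 'rV[R]_d) : R := Num.sqrt (\sum_(i < d) x ord0 i ^+ 2).

Definition ebasis (i : 'I_d) : 'rV[R]_d := delta_mx 0 i.

Definition partial (i : 'I_d) (f : 'rV[R]_d -> R) (x : 'rV[R]_d) : R :=
  'D_(ebasis i) f x.

Definition dlog (i : 'I_d) (f : 'rV[R]_d -> R) (x : 'rV[R]_d) : R :=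
  partial i (fun y => ln (f y)) x.

Definition set_coord (x : 'rV[R]_d) (j : 'I_d) (t : R) : 'rV[R]_d :=
  \row_(k < d) (if k == j then t else x ord0 k).

(* A product density on R^d is given by its d one-dimensional marginal
   densities  marg : 'I_d -> R -> R,  q(x) = prod_i marg i (x_i). *)
Definition prod_density (marg : 'I_d -> R -> R) (x : 'rV[R]_d) : R :=
  \prod_(i < d) marg i (x ord0 i).

Definition integ_coord (marg : 'I_d -> R -> R) (j : 'I_d)
  (F : 'rV[R]_d -> R) : 'rV[R]_d -> R :=
  fun x => Rintegral (@lebesgue_measure R) setT
             (fun t => marg j t * F (set_coord x j t)).

(* Integration of F against the product of the marginals over the coordinates
   listed in s (iterated Lebesgue integrals, Fubini). *)
Definition integ_coords (marg : 'I_d -> R -> R) (s : seq 'I_d)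
  (F : 'rV[R]_d -> R) : 'rV[R]_d -> R :=
  foldr (integ_coord marg) F s.

Definition prod_exp (marg : 'I_d -> R -> R) (F : 'rV[R]_d -> R) : R :=
  integ_coords marg (enum 'I_d) F 0.

(* E_{q_{-i}}[F] : expectation over all coordinates except x_i; the result,
   as a function of x, only depends on x_i. *)
Definition prod_exp_except (marg : 'I_d -> R -> R) (i : 'I_d)
  (F : 'rV[R]_d -> R) : 'rV[R]_d -> R :=
  integ_coords marg [seq j <- enum 'I_d | j != i] F.

Definition proj_fisher (marg : 'I_d -> R -> R) (p : 'rV[R]_d -> R) : R :=
  \sum_(i < d) prod_exp marg (fun x =>
     (prod_exp_except marg i
        (fun y => dlog i (prod_density marg) y - dlog i p y) x) ^+ 2).

Definition std_gauss_marg : 'I_d -> R -> R := fun _ => normal_pdf 0 1.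

Definition leb_int (F : 'rV[R]_d -> R) : R :=
  integ_coords (fun _ _ => 1) (enum 'I_d) F 0.

(* p_R(x) = p(R^T x); with row vectors, R^T x is written x *m R *)
Definition rot_density (Rm : 'M[R]_d) (p : 'rV[R]_d -> R) : 'rV[R]_d -> R :=
  fun x => p (x *m Rm).

Definition orthogonal_mx (Rm : 'M[R]_d) : Prop := Rm *m Rm^T = 1%:M.

Definition standing_assumptions (p : 'rV[R]_d -> R) : Prop :=
  [/\ (forall x, 0 < p x),
      leb_int p = 1,
      (forall x, differentiable p x) /\
        (forall i, continuous (partial i p)) &
      exists (c m : R), [/\ 0 < c, 2 <= m,
        (forall x, `|ln (p x)| <= c * (1 + powR (norm2 x) m)) &
        (forall x, Num.sqrt (\sum_(i < d) dlog i p x ^+ 2)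
                     <= c * (1 + powR (norm2 x) m))]].

Definition Hmat (p : 'rV[R]_d -> R) : 'M[R]_d :=
  \matrix_(i < d, j < d)
    prod_exp std_gauss_marg (fun x => x ord0 i * (dlog j p x + x ord0 j)).

Definition posdef (S : 'M[R]_d) : Prop :=
  S^T = S /\ forall v : 'rV[R]_d, v != 0 -> 0 < (v *m S *m v^T) ord0 ord0.

Definition gauss_density (S : 'M[R]_d) (x : 'rV[R]_d) : R :=
  expR (- (x *m invmx S *m x^T) ord0 ord0 / 2)
  / Num.sqrt ((pi *+ 2) ^+ d * \det S).

End Defs.

(* Main.v *)
(* Write f_i for the i-th coordinate of grad log gamma - grad log p_R and
   g_i(x_i) = E_{-i}[f_i].  Since E[x_i^2] = 1, Bessel's inequality gives
   E[g_i^2] >= E[x_i g_i]^2, and E[x_i g_i] = E[x_i f_i] by Fubini.  The change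
   of variables y = xR, which preserves gamma, turns E[x_i f_i] into
   - (R H R^T)_ii.  For Gaussian p each f_i is linear, so g_i is a multiple of
   x_i and the inequality is an equality.

   Expectations are iterated one-dimensional integrals, so the invariance of
   gamma under R is derived from Tonelli's theorem: Gaussian elimination writes
   R as a product of matrices that change a single coordinate affinely, hence
   the Lebesgue integral of F(xR) is c times that of F, and F = the density of
   gamma itself shows that c = 1. *)
Require Import Defs.
From HB Require Import structures.
From mathcomp Require Import all_boot all_order all_algebra.
From mathcomp Require Import all_classical all_reals all_analysis.
From mathcomp Require Import measurable_realfun normal_distribution.
From mathcomp Require Import ring lra.

Set Implicit Arguments.
Unset Strict Implicit.
Unset Printing Implicit Defensive.

Import Order.TTheory GRing.Theory Num.Theory.
Import numFieldNormedType.Exports.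

Local Open Scope classical_set_scope.
Local Open Scope ring_scope.

(** * Overwriting one coordinate of a vector *)

Section set_coord.
Context {R : realType} {d : nat}.
Implicit Types (x : 'rV[R]_d) (i j k : 'I_d).

Lemma set_coordE x j t k :
  set_coord x j t ord0 k = if k == j then t else x ord0 k.
Proof. by rewrite mxE. Qed.

Lemma set_coordC x i j s t : i != j ->
  set_coord (set_coord x i s) j t = set_coord (set_coord x j t) i s.
Proof.
move=> ij; apply/rowP => k; rewrite !set_coordE.
by case: eqP => // ->; rewrite eq_sym (negbTE ij).
Qed.

Lemma set_coord_set_coord x j s t :
  set_coord (set_coord x j s) j t = set_coord x j t.
Proof. by apply/rowP => k; rewrite !set_coordE; case: eqP. Qed.

End set_coord.

(** * Measurability of functions of a row vector *)

Section row_measurable.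
Context {R : realType} {d : nat}.

Definition row_of_tuple (u : d.-tuple R) : 'rV[R]_d := \row_i tnth u i.

(** Measurability is read through tuples, whose sigma-algebra is generated by the coordinates, so
    that it can be checked coordinate by coordinate and fed to Tonelli's theorem. *)
Definition row_measurable {dU} {U : measurableType dU} (F : 'rV[R]_d -> U) :=
  measurable_fun [set: d.-tuple R] (F \o row_of_tuple).

Lemma row_measurable_comp {dT dU} {T : measurableType dT}
    {U : measurableType dU} (F : 'rV[R]_d -> U) (h : T -> 'rV[R]_d) :
  row_measurable F ->
  (forall i, measurable_fun [set: T] (fun a => h a ord0 i)) ->
  measurable_fun [set: T] (F \o h).
Proof.
move=> mF mh.
have -> : F \o h = (F \o row_of_tuple) \o (fun a => [tuple h a ord0 i | i < d]).
  apply/funext => a /=; congr F; apply/rowP => i.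
  by rewrite mxE tnth_mktuple.
apply: measurableT_comp => //; apply/measurable_fun_tnthP => i.
apply: eq_measurable_fun (mh i) => a _ /=.
by rewrite tnth_mktuple.
Qed.

Lemma row_measurable_coord i : row_measurable (fun x : 'rV[R]_d => x ord0 i).
Proof.
apply: eq_measurable_fun (@measurable_tnth _ R d i) => u _ /=.
by rewrite mxE.
Qed.

Lemma measurable_row_of_tuple i :
  measurable_fun [set: d.-tuple R] (fun u => row_of_tuple u ord0 i).
Proof. exact: row_measurable_coord. Qed.

Lemma measurable_set_coord {dT} {T : measurableType dT} (h : T -> 'rV[R]_d)
    (g : T -> R) j :
  (forall i, measurable_fun [set: T] (fun a => h a ord0 i)) ->
  measurable_fun [set: T] g ->
  forall i, measurable_fun [set: T] (fun a => set_coord (h a) j (g a) ord0 i).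
Proof.
move=> mh mg i; under eq_fun do rewrite set_coordE.
by case: eqP => _; [exact: mg|exact: mh].
Qed.

Lemma row_measurable_slice {dU} {U : measurableType dU} (F : 'rV[R]_d -> U) x j :
  row_measurable F -> measurable_fun [set: R] (fun t => F (set_coord x j t)).
Proof.
move=> mF; apply: (row_measurable_comp mF).
exact: (@measurable_set_coord _ _ (fun _ => x) id).
Qed.

Lemma row_measurable_slice2 {dU} {U : measurableType dU} (F : 'rV[R]_d -> U) j :
  row_measurable F ->
  measurable_fun [set: d.-tuple R * R]
    (fun ut => F (set_coord (row_of_tuple ut.1) j ut.2)).
Proof.
move=> mF; apply: (row_measurable_comp mF).
apply: (@measurable_set_coord _ _
  (fun ut : d.-tuple R * R => row_of_tuple ut.1) snd) => //.
move=> i; apply: (measurableT_comp (measurable_row_of_tuple i)) => //.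
Qed.

Lemma row_measurable_mulmx {dU} {U : measurableType dU} (F : 'rV[R]_d -> U)
    (A : 'M[R]_d) : row_measurable F -> row_measurable (fun x => F (x *m A)).
Proof.
move=> mF; apply: (row_measurable_comp mF) => i /=.
under eq_fun do rewrite mxE.
by apply: measurable_sum => k; apply: measurable_funM => //;
  exact: measurable_row_of_tuple.
Qed.

(** An open superlevel set is a countable union of cubes with rational centres and radii [1/(n+1)],
    and each cube is a finite intersection of coordinate cylinders. *)
Lemma continuous_row_measurable (F : 'rV[R]_d -> R) :
  continuous F -> row_measurable F.
Proof.
move=> cF.
have openF a : open [set x | a < F x].
  have -> : [set x | a < F x] = F @^-1` [set` `]a, +oo[].
    by apply/seteqP; split=> x /=; rewrite in_itv/= andbT.
  by apply: open_comp => //; exact: interval_open.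
apply: (measurability _ (RGenOInfty.measurableE R)) => //.
move=> _ [_ [a ->] <-]; rewrite setTI.
pose V := [set x | a < F x].
have -> : (F \o row_of_tuple) @^-1` `]a, +oo[%classic =
   \bigcup_(qn in [set qn : d.-tuple rat * nat |
      forall y : 'rV[R]_d,
        (forall i, `|y ord0 i - ratr (tnth qn.1 i)| < (qn.2.+1%:R)^-1) -> V y])
     \bigcap_(i in [set: 'I_d]) ((fun u => tnth u i) @^-1`
        (ball (ratr (tnth qn.1 i) : R) (qn.2.+1%:R)^-1)).
  apply/seteqP; split=> u /=.
    rewrite in_itv/= andbT => aFu.
    have : nbhs (row_of_tuple u) V by apply: open_nbhs_nbhs; split => //; exact: openF.
    rewrite -nbhs_ballE => -[e /= e0 eV].
    (* Half of [e] serves for the distance from the point to the rational centre, the other half for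
       the distance from the centre to any other point of the cube. *)
    have e20 : 0 < e / 2 by rewrite divr_gt0.
    pose n := Num.truncn (e / 2)^-1.
    have ne : (n.+1%:R)^-1 < e / 2.
      rewrite -ltf_pV2 ?posrE// ?invr_gt0// invrK.
      exact: truncnS_gt.
    have n0 : 0 < (n.+1%:R)^-1 :> R by rewrite invr_gt0.
    have : forall i : 'I_d, exists q : rat, `|tnth u i - ratr q| < (n.+1%:R)^-1.
      move=> i.
      have /rat_in_itvoo[q] : tnth u i - (n.+1%:R)^-1 < tnth u i + (n.+1%:R)^-1.
        by rewrite ltrBlDr -addrA ltrDl addr_gt0.
      rewrite in_itv/= => /andP[q1 q2]; exists q.
      by rewrite distrC ltr_distl q1 q2.
    move=> /choice[q qP]; exists ([tuple q i | i < d], n).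
      move=> y /= yq; apply: eV; split=> // i0 i.
      rewrite /ball/= (ord1 i0) mxE.
      have := yq i; rewrite tnth_mktuple => yqi.
      have := qP i => uqi.
      rewrite -(subrK (ratr (q i)) (tnth u i)) -addrA.
      rewrite (le_lt_trans (ler_normD _ _))// (splitr e) ltrD//.
        exact: lt_trans uqi ne.
      by rewrite distrC; exact: lt_trans yqi ne.
    by move=> i _ /=; rewrite tnth_mktuple /ball/= distrC; exact: qP.
  move=> [[q n]] /= qV uq; rewrite in_itv/= andbT; apply: qV => i.
  by rewrite mxE distrC; exact: (uq i I).
rewrite bigcup_mkcond; apply: countable_bigcupT_measurable.
  exact: countableP.
move=> -[q n].
case: ifPn => // _.
apply: fin_bigcap_measurable => [|i _]; first exact: finite_finset.
rewrite -[X in measurable X]setTI.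
apply: measurable_tnth => //.
exact: measurable_ball.
Qed.

End row_measurable.

(** * Affine substitution in a one-dimensional integral *)

Section affine_substitution.
Context {R : realType}.
Local Notation mu := (@lebesgue_measure R).

(** By uniqueness of Lebesgue measure it is enough to compare the two sides on half-open intervals.
    For [a < 0] the preimage is closed on the other side, which does not alter its length. *)
Lemma lebesgue_measure_affine (a b : R) (A : set R) : a != 0 -> measurable A ->
  (mu A = `|a|%:E * pushforward mu (fun t => (a * t + b)%R : measurableTypeR R) A)%E.
Proof.
move=> a0 mA.
have mphi : measurable_fun [set: R] (fun t : R => a * t + b : measurableTypeR R).
  by apply: measurable_funD => //; exact: measurable_funM.
pose k : {nonneg R} := NngNum (normr_ge0 a).
apply: (@lebesgue_measure_unique _
  (mscale k (pushforward mu (fun t => a * t + b : measurableTypeR R)))) => //.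
move=> /= _ [[x y]] _ <-.
rewrite /mscale /= /pushforward.
have [ap|an|/eqP] := ltgtP a 0; last by rewrite (negbTE a0).
  rewrite [X in (_ * _ X)%E](_ : _ = [set` `[(y - b) / a, (x - b) / a[]); last first.
    apply/seteqP; split=> t /=; rewrite !in_itv/=.
      by rewrite ler_ndivrMr// ltr_ndivlMr// lerBrDr ltrBlDr mulrC andbC.
    by rewrite ler_ndivrMr// ltr_ndivlMr// lerBrDr ltrBlDr mulrC andbC.
  rewrite !lebesgue_measure_itv/= !lte_fin ltr_nM2r ?invr_lt0// ltrD2r.
  case: ifPn => xy; last by rewrite mule0.
  rewrite -!EFinB -EFinM ltr0_norm//; congr (_%:E).
  by field.
rewrite [X in (_ * _ X)%E](_ : _ = [set` `](x - b) / a, (y - b) / a]]); last first.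
  apply/seteqP; split=> t /=; rewrite !in_itv/=.
    by rewrite ltr_pdivrMr// ler_pdivlMr// lerBrDr ltrBlDr mulrC.
  by rewrite ltr_pdivrMr// ler_pdivlMr// lerBrDr ltrBlDr mulrC.
rewrite !lebesgue_measure_itv/= !lte_fin ltr_pM2r ?invr_gt0// ltrD2r.
case: ifPn => xy; last by rewrite mule0.
rewrite -!EFinB -EFinM gtr0_norm//; congr (_%:E).
by field.
Qed.

Lemma ge0_integral_affine (a b : R) (f : R -> \bar R) : a != 0 ->
  measurable_fun [set: R] f -> (forall t, 0 <= f t)%E ->
  (\int[mu]_t f (a * t + b)%R = (`|a|^-1)%:E * \int[mu]_t f t)%E.
Proof.
move=> a0 mf f0.
have mphi : measurable_fun [set: R] (fun t : R => a * t + b : measurableTypeR R).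
  by apply: measurable_funD => //; exact: measurable_funM.
pose k : {nonneg R} := NngNum (normr_ge0 a).
rewrite [in RHS](eq_measure_integral
  (mscale k (pushforward mu (fun t : R => a * t + b : measurableTypeR R)))); last first.
  by move=> A mA _; exact: lebesgue_measure_affine.
rewrite ge0_integral_mscale// ge0_integral_pushforward//.
by rewrite /= muleA -EFinM mulVf ?normr_eq0// mul1e preimage_setT.
Qed.

End affine_substitution.

(** * Tonelli's theorem for iterated integrals over coordinates *)

Section iterated_integral.
Context {R : realType} {d : nat}.
Local Notation mu := (@lebesgue_measure R).
Local Open Scope ereal_scope.
Implicit Types (F : 'rV[R]_d -> \bar R) (s : seq 'I_d) (j : 'I_d).

(** An unweighted, extended-real counterpart of [integ_coord]: for nonnegative measurable integrands
    the order of integration can be changed without any integrability condition. *)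
Definition int_coord j F : 'rV[R]_d -> \bar R :=
  fun x => \int[mu]_t F (set_coord x j t).

Definition int_coords s F : 'rV[R]_d -> \bar R := foldr int_coord F s.

Definition ge0_row_measurable F := row_measurable F /\ forall x, 0 <= F x.

Lemma ge0_row_measurable_int_coord j F :
  ge0_row_measurable F -> ge0_row_measurable (int_coord j F).
Proof.
move=> [mF F0]; split; last by move=> x; apply: integral_ge0.
exact: (@measurable_fun_fubini_tonelli_F _ _ _ _ R mu _
  (row_measurable_slice2 j mF) (fun _ => F0 _)).
Qed.

Lemma ge0_row_measurable_int_coords s F :
  ge0_row_measurable F -> ge0_row_measurable (int_coords s F).
Proof. by move=> mF; elim: s => //= j s; exact: ge0_row_measurable_int_coord. Qed.

Lemma ge0_row_measurable_mulmx (A : 'M[R]_d) F :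
  ge0_row_measurable F -> ge0_row_measurable (fun x => F (x *m A)).
Proof. by move=> [mF F0]; split => //; exact: row_measurable_mulmx. Qed.

Lemma int_coordC i j F : ge0_row_measurable F ->
  int_coord i (int_coord j F) = int_coord j (int_coord i F).
Proof.
move=> [mF F0]; have [->//|ij] := eqVneq i j.
apply/funext => x; rewrite /int_coord.
rewrite (@fubini_tonelli _ _ _ _ R mu mu
  (fun st : R * R => F (set_coord (set_coord x i st.1) j st.2)))//=.
  by under eq_integral do under eq_integral do rewrite set_coordC//.
apply: (row_measurable_comp mF).
apply: (@measurable_set_coord _ _ _ _ (fun st : R * R => set_coord x i st.1) snd) => //.
exact: (@measurable_set_coord _ _ _ _ (fun st : R * R => x) fst).
Qed.

Lemma int_coord_int_coords j s F : ge0_row_measurable F ->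
  int_coord j (int_coords s F) = int_coords s (int_coord j F).
Proof.
move=> mF; elim: s => //= i s IH.
by rewrite int_coordC ?IH//; exact: ge0_row_measurable_int_coords.
Qed.

(** Any chosen coordinate can be moved to the innermost integral, where a one-dimensional
    substitution applies to it. *)
Lemma int_coords_rem j s F : ge0_row_measurable F -> j \in s ->
  int_coords s F = int_coords (rem j s) (int_coord j F).
Proof.
move=> mF; elim: s => //= i s IH; rewrite inE.
have [->|ij] := eqVneq i j; first by rewrite int_coord_int_coords.
by move=> js; rewrite /= IH.
Qed.

Lemma int_coords_scale s F (c : R) : (0 <= c)%R -> ge0_row_measurable F ->
  int_coords s (fun x => c%:E * F x) = fun x => c%:E * int_coords s F x.
Proof.
move=> c0 mF; elim: s => //= j s ->; apply/funext => x.
rewrite /int_coord ge0_integralZl_EFin//.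
  by move=> t _; exact: (ge0_row_measurable_int_coords s mF).2.
by apply: row_measurable_slice; exact: (ge0_row_measurable_int_coords s mF).1.
Qed.

End iterated_integral.

(** * Linear substitution by Gaussian elimination *)

Section linear_substitution.
Context {R : realType} {d : nat}.
Local Open Scope ereal_scope.

(** The base point 0 is immaterial: every coordinate is overwritten by an integration variable. *)
Definition lint (F : 'rV[R]_d -> \bar R) : \bar R := int_coords (enum 'I_d) F 0%R.

(** The factor stays existential, which makes the property stable under products; for orthogonal
    matrices its value is found later by testing on the Gaussian density. *)
Definition scales_lint (A : 'M[R]_d) := exists2 c : R, (0 < c)%R &
  forall F, ge0_row_measurable F -> lint (fun x => F (x *m A)) = c%:E * lint F.

Lemma scales_lint_mul (A B : 'M[R]_d) :
  scales_lint A -> scales_lint B -> scales_lint (A *m B).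
Proof.
move=> [a a0 sA] [b b0 sB]; exists (a * b)%R; first exact: mulr_gt0.
move=> F mF; have -> : (fun x => F (x *m (A *m B))) = (fun x => F (x *m A *m B)).
  by apply/funext => x; rewrite mulmxA.
rewrite (sA (fun x => F (x *m B))); last exact: ge0_row_measurable_mulmx.
by rewrite sB// muleA EFinM.
Qed.

(** The elementary factors of the elimination: acting on row vectors from the right, such a matrix
    changes coordinate [k] only. *)
Definition id_with_col (k : 'I_d) (v : 'cV[R]_d) : 'M[R]_d :=
  \matrix_(i, j) if j == k then v i ord0 else (i == j)%:R%R.

Lemma mulmx_id_with_col (x : 'rV[R]_d) k v :
  x *m id_with_col k v = set_coord x k ((x *m v) ord0 ord0).
Proof.
apply/rowP => j; rewrite set_coordE !mxE; case: eqP => [->|jk].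
  by apply: eq_bigr => i _; rewrite mxE eqxx.
rewrite (bigD1 j)//= big1 ?addr0 => [|i ij].
  by rewrite mxE eqxx; case: eqP => // _; rewrite mulr1.
by rewrite mxE (negbTE ij); case: eqP => // _; rewrite mulr0.
Qed.

Lemma mul_id_with_colE k v (B : 'M[R]_d) i j :
  ((id_with_col k v *m B) i j = v i ord0 * B k j + (i != k)%:R * B i j)%R.
Proof.
rewrite mxE (bigD1 k)//= mxE eqxx; congr (_ + _)%R.
have [->|ik] := eqVneq i k; rewrite /= ?mul0r ?mul1r.
  by rewrite big1// => l lk; rewrite mxE (negbTE lk) eq_sym (negbTE lk) mul0r.
rewrite (bigD1 i)//= mxE (negbTE ik) eqxx mul1r big1 ?addr0// => l /andP[lk li].
by rewrite mxE (negbTE lk) eq_sym (negbTE li) mul0r.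
Qed.

(** With coordinate [k] integrated innermost, the map is affine in that variable with slope
    [v k ord0], so the one-dimensional substitution gives the factor. *)
Lemma scales_lint_id_with_col k (v : 'cV[R]_d) :
  v k ord0 != 0%R -> scales_lint (id_with_col k v).
Proof.
move=> vk0; exists (`|v k ord0|^-1)%R; first by rewrite invr_gt0 normr_gt0.
move=> F mF; rewrite /lint.
rewrite (int_coords_rem (j := k)) ?mem_enum//; last first.
  exact: ge0_row_measurable_mulmx.
rewrite (int_coords_rem mF (j := k)) ?mem_enum//.
have -> : int_coord k (fun x => F (x *m id_with_col k v)) =
    fun x => (`|v k ord0|^-1)%:E * int_coord k F x.
  apply/funext => x; rewrite /int_coord.
  (* The contribution of the other coordinates, constant with respect to the integration
     variable. *)
  pose b := (set_coord x k 0%R *m v) ord0 ord0.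
  rewrite -(ge0_integral_affine b vk0 (row_measurable_slice x k mF.1)); last first.
    by move=> t; exact: mF.2.
  apply: eq_integral => t _.
  rewrite mulmx_id_with_col set_coord_set_coord; congr (F (set_coord _ _ _)).
  have -> : set_coord x k t = (t *: delta_mx ord0 k + set_coord x k 0)%R.
    apply/rowP => j; rewrite !mxE eqxx andTb.
    by case: eqP => _; rewrite ?mulr1 ?mulr0 ?addr0 ?add0r.
  rewrite mulmxDl mxE -/b -scalemxAl -rowE !mxE mulrC.
  by [].
rewrite int_coords_scale//; exact: ge0_row_measurable_int_coord.
Qed.

Lemma scales_lint1 : scales_lint 1%:M.
Proof.
by exists 1%R => // F _; rewrite mul1e; under eq_fun do rewrite mulmx1.
Qed.

(** The invariant of the elimination: the first [k] columns are already those of the identity. *)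
Definition id_upto k (A : 'M[R]_d) :=
  forall i j : 'I_d, (j < k)%N -> A i j = (i == j)%:R%R.

(** Otherwise column [k] would be supported on the rows above [k], hence a combination of the
    preceding columns, against invertibility. *)
Lemma id_upto_pivot (A : 'M[R]_d) (k : 'I_d) : A \in unitmx -> id_upto k A ->
  exists2 i : 'I_d, (k <= i)%N & A i k != 0%R.
Proof.
move=> uA idA; apply: contrapT => noP.
have zA (i : 'I_d) : (k <= i)%N -> A i k = 0%R.
  by move=> ki; apply/eqP/negP => /negP Aik; apply: noP; exists i.
(* The kernel vector that encodes this dependence: column [k] minus its combination of the first [k]
   unit columns. *)
pose u : 'cV[R]_d := (\col_j if (j < k)%N then - A j k else (j == k)%:R)%R.
have Au0 : A *m u = 0%R.
  apply/colP => i; rewrite !mxE (bigD1 k)//= mxE ltnn eqxx mulr1.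
  have [ik|ki] := ltnP i k.
    rewrite (bigD1 i)/=; last by rewrite -val_eqE /= ltn_eqF.
    rewrite mxE ik (idA i i)// eqxx mul1r big1 ?addr0 ?subrr// => j /andP[jk ji].
    rewrite mxE; case: ifPn => jltk; first by rewrite idA// eq_sym (negbTE ji) mul0r.
    by rewrite (negbTE jk) mulr0.
  rewrite zA// add0r big1// => j jk; rewrite mxE; case: ifPn => jltk.
    by rewrite idA// -val_eqE /= gtn_eqF ?mul0r// (leq_trans jltk).
  by rewrite (negbTE jk) mulr0.
have : u = 0%R by rewrite -(mulKmx uA u) Au0 mulmx0.
move=> /colP/(_ k); rewrite !mxE ltnn eqxx => /eqP.
by rewrite oner_eq0.
Qed.

(** Row [k] is divided by the pivot and its multiples are subtracted from the other rows. Undoing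
    this is multiplication by the identity with column [k] replaced by that of [A], and the reduced
    matrix has one more identity column. *)
Lemma scales_lint_step (k : 'I_d) (A : 'M[R]_d) :
  (forall B, B \in unitmx -> id_upto k.+1 B -> scales_lint B) ->
  A \in unitmx -> id_upto k A -> A k k != 0%R -> scales_lint A.
Proof.
move=> IH uA idA Akk.
pose B : 'M[R]_d := (\matrix_(i, j) if i == k then A k j / A k k
                     else A i j - A i k * (A k j / A k k))%R.
have AE : A = id_with_col k (col k A) *m B.
  apply/matrixP => i j; rewrite mul_id_with_colE !mxE eqxx.
  have [->|ik] /= := eqVneq i k; first by rewrite mul0r addr0 mulrC divfK.
  by rewrite mul1r addrC subrK.
rewrite AE; apply: scales_lint_mul; first by apply: scales_lint_id_with_col; rewrite mxE.
apply: IH; first by move: uA; rewrite {1}AE unitmx_mul => /andP[].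
move=> i j; rewrite ltnS leq_eqVlt => /orP[/eqP/val_inj ->|jk].
  by rewrite mxE divff// mulr1 subrr; case: eqP.
have kj : (k == j) = false by rewrite -val_eqE /= gtn_eqF.
rewrite mxE !(fun i => idA i j jk) kj mul0r mulr0 subr0.
by case: eqP => // ->; rewrite kj.
Qed.

(** Induction on the number [n] of columns still to be cleared. A zero pivot is first repaired by
    adding to its row a lower row that is nonzero in that column. *)
Lemma scales_lint_unitmx (A : 'M[R]_d) : A \in unitmx -> scales_lint A.
Proof.
have main n : forall k, (k + n = d)%N -> forall B : 'M[R]_d, B \in unitmx ->
    id_upto k B -> scales_lint B.
  elim: n => [|n IH] k kd B uB idB.
    have -> : B = 1%:M; last exact: scales_lint1.
    by apply/matrixP => i j; rewrite idB ?mxE// -[k]addn0 kd.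
  have kltd : (k < d)%N by rewrite -kd addnS ltnS leq_addr.
  pose kk := Ordinal kltd.
  have IHk C : C \in unitmx -> id_upto kk.+1 C -> scales_lint C.
    by apply: IH; rewrite /= addSn -addnS.
  have [Bkk|] := eqVneq (B kk kk) 0%R; last exact: scales_lint_step.
  have [i ki Bik] := @id_upto_pivot B kk uB idB.
  have ik : i != kk by apply: contraNneq Bik => ->; rewrite Bkk.
  (* [C] is [B] with row [i] added to row [kk]; the factor built from [v] subtracts that row again.
     Since [i] is at least [kk], row [i] vanishes on the cleared columns, so these are preserved. *)
  pose v : 'cV[R]_d := (\col_l ((l == i)%:R - (l == kk)%:R))%R.
  pose C : 'M[R]_d := (\matrix_(l, j) (B l j + (l == kk)%:R * B i j))%R.
  have BE : B = id_with_col i v *m C.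
    apply/matrixP => l j; rewrite mul_id_with_colE !mxE (negbTE ik) mul0r addr0.
    have [->|li] /= := eqVneq l i; first by rewrite (negbTE ik) subr0 mul1r !mul0r addr0.
    by rewrite mul1r sub0r mulNr addrCA addNr addr0.
  rewrite BE; apply: scales_lint_mul.
    by apply: scales_lint_id_with_col; rewrite mxE eqxx (negbTE ik) subr0 oner_eq0.
  apply: (@scales_lint_step kk) => //.
  - by move: uB; rewrite {1}BE unitmx_mul => /andP[].
  - move=> l j jk; rewrite mxE idB// (idB i)// (_ : i == j = false) ?mulr0 ?addr0//.
    by rewrite -val_eqE /= gtn_eqF// (leq_trans jk).
  - by rewrite mxE eqxx mul1r Bkk add0r.
by move=> uA; exact: (main d 0%N).
Qed.

End linear_substitution.

(** * Integrability and first two moments of the standard normal law *)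

Section gaussian_moments.
Context {R : realType}.
Local Notation mu := (@lebesgue_measure R).
Local Notation phi := (@normal_pdf R 0 1).

Lemma std_normal_pdfE t : phi t = normal_peak 1 * expR (- t ^+ 2 / 2).
Proof. by rewrite normal_pdfE ?oner_eq0// /normal_fun subr0 expr1n. Qed.

Lemma std_normal_pdf_gt0 t : 0 < phi t.
Proof. by rewrite std_normal_pdfE mulr_gt0 ?expR_gt0// normal_peak_gt0// oner_eq0. Qed.

(** Domination by the density of variance 2: half of the Gaussian exponent is kept, and the other
    half absorbs the polynomial. *)
Lemma integrable_std_normal_poly K :
  mu.-integrable setT (fun t => (phi t * (1 + t ^+ 2) ^+ K)%:E).
Proof.
have s2 : Num.sqrt 2 != 0 :> R by rewrite sqrtr_eq0 -ltNge.
(* The ratio of the peaks, times the constant in [(4u)^(K+1) <= 4^(K+1) (K+1)! e^u] at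
   [u = (1 + t^2)/4], where [e^u = e^(1/4) e^(t^2/4)]. The degree is raised to [K+1] to match
   [expR_ge1Dxn]. *)
pose C : R := normal_peak 1 / normal_peak (Num.sqrt 2) *
  (4 ^+ K.+1 * K.+1`!%:R * expR (4^-1)).
have C0 : 0 <= C.
  rewrite mulr_ge0// ?mulr_ge0 ?invr_ge0 ?normal_peak_ge0 ?expR_ge0//.
apply: (@le_integrable _ _ R mu setT measurableT _
  (fun t => C%:E * (normal_pdf 0 (Num.sqrt 2) t)%:E)%E) => //.
- apply/measurable_EFinP; apply: measurable_funM; first exact: measurable_normal_pdf.
  by apply: measurable_funX; apply: measurable_funD => //; exact: measurable_funX.
- move=> t _; rewrite -EFinM !abse_EFin lee_fin !ger0_norm; first last.
  + by rewrite mulr_ge0 ?normal_pdf_ge0// exprn_ge0// addr_ge0 ?sqr_ge0.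
  + by rewrite mulr_ge0 ?normal_pdf_ge0.
  have t1 : 1 <= 1 + t ^+ 2 by rewrite lerDl sqr_ge0.
  pose u := (1 + t ^+ 2) / 4.
  have u0 : 0 <= u by rewrite divr_ge0// (le_trans ler01).
  have tu : 1 + t ^+ 2 = 4 * u by rewrite /u mulrC divfK.
  rewrite std_normal_pdfE normal_pdfE// /normal_fun subr0 sqr_sqrtr//.
  have -> : expR (- t ^+ 2 / 2) = expR (- t ^+ 2 / (2 *+ 2)) * expR (- t ^+ 2 / 4) :> R.
    by rewrite -expRD; congr expR; field.
  have Eu : expR u = expR (4^-1) * expR (t ^+ 2 / 4).
    by rewrite -expRD; congr expR; rewrite /u; field.
  have E4 : expR (- t ^+ 2 / 4) * expR (t ^+ 2 / 4) = 1.
    by rewrite -expRD mulNr addNr expR0.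
  have pk : 0 < normal_peak (Num.sqrt 2) :> R by rewrite normal_peak_gt0.
  have -> : C * (normal_peak (Num.sqrt 2) * expR (- t ^+ 2 / (2 *+ 2))) =
     normal_peak 1 * expR (- t ^+ 2 / (2 *+ 2)) * (4 ^+ K.+1 * K.+1`!%:R * expR (4^-1)).
    by rewrite /C; field; rewrite gt_eqF.
  rewrite [normal_peak 1 * (_ * _)]mulrA -[leLHS]mulrA.
  rewrite ler_wpM2l ?mulr_ge0 ?normal_peak_ge0 ?expR_ge0//.
  rewrite -[leRHS]mul1r -[X in _ <= X * _]E4 -[leRHS]mulrA ler_wpM2l ?expR_ge0//.
  rewrite [leRHS]mulrC -[leRHS]mulrA -Eu (@le_trans _ _ ((1 + t ^+ 2) ^+ K.+1))//.
    by rewrite [leRHS]exprS ler_peMl// exprn_ge0// (le_trans ler01).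
  rewrite tu exprMn -mulrA ler_wpM2l ?exprn_ge0//.
  rewrite mulrC -ler_pdivrMr ?ltr0n ?fact_gt0//.
  by rewrite (le_trans _ (expR_ge1Dxn K u0))// lerDr.
- by apply: integrableZl => //; exact: integrable_normal_pdf.
Qed.

Lemma integrable_std_normal_mul (f : R -> R) (C : R) K :
  measurable_fun setT f -> (forall t, `|f t| <= C * (1 + t ^+ 2) ^+ K) ->
  mu.-integrable setT (EFin \o (fun t => phi t * f t)).
Proof.
move=> mf fC.
apply: (@le_integrable _ _ R mu setT measurableT _
  (fun t => C%:E * (phi t * (1 + t ^+ 2) ^+ K)%:E)%E) => //.
- apply/measurable_EFinP; apply: measurable_funM => //; exact: measurable_normal_pdf.
- move=> t _; rewrite -EFinM !abse_EFin lee_fin (le_trans _ (ler_norm _))//.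
  rewrite normrM (ger0_norm (normal_pdf_ge0 _ _ _)) mulrCA ler_wpM2l ?normal_pdf_ge0//.
- by apply: integrableZl => //; exact: integrable_std_normal_poly.
Qed.

(** The reflection of [t] exchanges the integrals of [phi t * (1 + t)^2] and [phi t * (1 - t)^2],
    which differ by four times the mean. The squares make the integrands nonnegative, as
    [ge0_integral_affine] requires. *)
Lemma std_normal_mean : \int[mu]_t (phi t * t) = 0.
Proof.
have i1 : mu.-integrable setT (EFin \o (fun t => phi t * t)).
  apply: (@integrable_std_normal_mul id 1 1) => // t.
  rewrite mul1r expr1; have := sqr_ge0 (`|t| - 1).
  by rewrite sqrrB real_normK ?num_real//; nra.
have i2 : mu.-integrable setT (EFin \o (fun t => phi t * t ^+ 2)).
  apply: (@integrable_std_normal_mul (fun t => t ^+ 2) 1 1) => [|t].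
    exact: measurable_funX.
  by rewrite mul1r expr1 ger0_norm ?sqr_ge0// lerDr.
have i0 : mu.-integrable setT (EFin \o phi) by exact: integrable_normal_pdf.
have ic c : mu.-integrable setT (EFin \o (fun t => c * (phi t * t))).
  exact: (integrableZl measurableT _ i1).
have E c : \int[mu]_t (phi t * t ^+ 2 + (c * (phi t * t) + phi t)) =
    \int[mu]_t (phi t * t ^+ 2) + (c * \int[mu]_t (phi t * t) + \int[mu]_t phi t).
  rewrite RintegralD//; last exact: (integrableD measurableT (ic c) i0).
  by rewrite RintegralD// RintegralZl.
have : \int[mu]_t (phi t * t ^+ 2 + (2 * (phi t * t) + phi t)) =
       \int[mu]_t (phi t * t ^+ 2 + (-2 * (phi t * t) + phi t)).
  pose f (t : R) := (phi t * (1 + t) ^+ 2)%:E.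
  have f0 t : (0 <= f t)%E by rewrite lee_fin mulr_ge0 ?normal_pdf_ge0 ?sqr_ge0.
  have mf : measurable_fun setT f.
    apply/measurable_EFinP; apply: measurable_funM; first exact: measurable_normal_pdf.
    by apply: measurable_funX; exact: measurable_funD.
  have N1 : -1 != 0 :> R by rewrite oppr_eq0 oner_eq0.
  have := ge0_integral_affine 0 N1 mf f0.
  rewrite normrN1 invr1 mul1e => Ef.
  transitivity (fine (\int[mu]_t f t)%E).
    by congr fine; apply: eq_integral => t _; congr (_%:E); ring.
  rewrite -Ef; congr fine; apply: eq_integral => t _; congr (_%:E).
  rewrite addr0 mulN1r !std_normal_pdfE sqrrN; ring.
rewrite !E => /addrI/addIr; move: (Rintegral _ _ _) => m; lra.
Qed.

(* [expR u >= 1 + u] bounds the N(0, s^2) density below by a multiple of the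
   standard one; integrating and letting [s] tend to 1 from both sides squeezes
   the second moment. *)
Lemma std_normal_second_moment_le (s : R) : 0 < s ->
  (1 - s ^- 2) / 2 * \int[mu]_t (phi t * t ^+ 2) <= s - 1.
Proof.
move=> s0.
have i2 : mu.-integrable setT (EFin \o (fun t => phi t * t ^+ 2)).
  apply: (@integrable_std_normal_mul (fun t => t ^+ 2) 1 1) => [|t].
    exact: measurable_funX.
  by rewrite mul1r expr1 ger0_norm ?sqr_ge0// lerDr.
have is_ : mu.-integrable setT (EFin \o normal_pdf 0 s) by exact: integrable_normal_pdf.
have i1 : mu.-integrable setT (EFin \o phi) by exact: integrable_normal_pdf.
have Es : \int[mu]_t (s * normal_pdf 0 s t) = s.
  by rewrite RintegralZl// /Rintegral integral_normal_pdf mulr1.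
have E1 : \int[mu]_t (phi t) = 1 by rewrite /Rintegral integral_normal_pdf.
rewrite lerBrDr -[X in _ + X <= _]E1 -[leRHS]Es -RintegralZl// -RintegralD//; last first.
  exact: (integrableZl measurableT _ i2).
apply: le_Rintegral => //.
- exact: (integrableD measurableT (integrableZl measurableT _ i2) i1).
- exact: (integrableZl measurableT _ is_).
move=> t _; rewrite std_normal_pdfE normal_pdfE ?gt_eqF// /normal_fun subr0.
have -> : normal_peak s = normal_peak 1 / s :> R.
  rewrite /normal_peak expr1n mul1r -mulrnAr sqrtrM ?sqr_ge0// sqrtr_sqr gtr0_norm//.
  by rewrite invfM mulrC.
have -> : expR (- t ^+ 2 / (s ^+ 2 *+ 2)) =
    expR (- t ^+ 2 / 2) * expR ((1 - s ^- 2) / 2 * t ^+ 2) :> R.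
  rewrite -expRD; congr expR; rewrite -exprVn -mulr_natr.
  by field; rewrite gt_eqF.
have := expR_ge1Dx ((1 - s ^- 2) / 2 * t ^+ 2).
set u := (1 - s ^- 2) / 2 * t ^+ 2; set e := expR (- t ^+ 2 / 2).
have pe : 0 <= normal_peak 1 * e by rewrite mulr_ge0 ?normal_peak_ge0 ?expR_ge0.
move=> /(ler_wpM2l pe); rewrite mulrDr mulr1.
have -> : s * (normal_peak 1 / s * (e * expR u)) = normal_peak 1 * e * expR u.
  by field; rewrite gt_eqF.
by rewrite [in X in _ -> X]addrC [(1 - s ^- 2) / 2 * (_ * _)]mulrCA.
Qed.

Lemma std_normal_second_moment : \int[mu]_t (phi t * t ^+ 2) = 1.
Proof.
set M := Rintegral _ _ _.
have H s : 0 < s -> (s ^+ 2 - 1) * M <= 2 * s ^+ 2 * (s - 1).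
  move=> s0; have := std_normal_second_moment_le s0; rewrite -/M => h.
  have s2 : 0 <= 2 * s ^+ 2 by rewrite mulr_ge0 ?sqr_ge0.
  have := ler_wpM2l s2 h.
  rewrite -exprVn.
  have -> : 2 * s ^+ 2 * ((1 - s^-1 ^+ 2) / 2 * M) = (s ^+ 2 - 1) * M.
    by field; rewrite gt_eqF.
  by [].
(* Division of [H] by [s - 1] yields an upper bound on [M] for [s > 1] and a lower bound for
   [s < 1]. *)
have Hgt s : 1 < s -> (s + 1) * M <= 2 * s ^+ 2.
  move=> s1; have s10 : 0 < s - 1 by lra.
  by rewrite -(ler_pM2r s10); have := H s (lt_trans ltr01 s1); nra.
have Hlt s : 0 < s -> s < 1 -> 2 * s ^+ 2 <= (s + 1) * M.
  move=> s0 s1; have s10 : 0 < 1 - s by lra.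
  by rewrite -(ler_pM2r s10); have := H s s0; nra.
(* If [M = 1 + 5e] with [e > 0], then [s = 1 + e] would force [7e + 3e^2 <= 0]. If [M = 1 - 5e],
   then [s = 1 - e] would force [7e <= 3e^2]; the crude bound from [s = 1/2] keeps [e] small and [s]
   positive. *)
apply/eqP; rewrite eq_le; apply/andP; split; rewrite leNgt; apply/negP => M1.
  have M3 : 3 * M <= 8 by have := Hgt 2 ltac:(lra); lra.
  by have := Hgt (1 + (M - 1) / 5) ltac:(lra); nra.
have M3 : 1 <= 3 * M by have := Hlt 2^-1 ltac:(lra) ltac:(lra); lra.
by have := Hlt (1 - (1 - M) / 5) ltac:(lra) ltac:(lra); nra.
Qed.

End gaussian_moments.

(** * Functions of polynomial growth and their partial Gaussian integrals *)

Section tempered.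
Context {R : realType} {d : nat}.
Local Notation mu := (@lebesgue_measure R).
Local Notation phi := (@normal_pdf R 0 1).
Local Notation gauss := (@std_gauss_marg R d).
Implicit Types (F G : 'rV[R]_d -> R) (x : 'rV[R]_d) (i j : 'I_d) (s : seq 'I_d).

Definition sqnorm x : R := \sum_i x ord0 i ^+ 2.

Lemma sqnorm_ge0 x : 0 <= sqnorm x.
Proof. by apply: sumr_ge0 => i _; exact: sqr_ge0. Qed.

Lemma sqnorm1_ge1 x : 1 <= 1 + sqnorm x.
Proof. by rewrite lerDl sqnorm_ge0. Qed.

Lemma sqnorm1_ge0 x : 0 <= 1 + sqnorm x.
Proof. exact: le_trans (sqnorm1_ge1 x). Qed.

Lemma sqnorm_mulmx (A : 'M[R]_d) x : orthogonal_mx A -> sqnorm (x *m A) = sqnorm x.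
Proof.
move=> oA; have sqnormE y : sqnorm y = (y *m y^T) ord0 ord0.
  by rewrite mxE; apply: eq_bigr => i _; rewrite mxE expr2.
by rewrite !sqnormE trmx_mul mulmxA -(mulmxA x) oA mulmx1.
Qed.

Lemma sqnorm1_set_coord x j t :
  1 + sqnorm (set_coord x j t) <= (1 + sqnorm x) * (1 + t ^+ 2).
Proof.
apply: (@le_trans _ _ (1 + sqnorm x + t ^+ 2)).
  rewrite -addrA lerD2l /sqnorm (bigD1 j)//= [X in _ <= X + _](bigD1 j)//=.
  rewrite set_coordE eqxx addrC lerD2r.
  rewrite (eq_bigr (fun i => x ord0 i ^+ 2)) ?lerDr ?sqr_ge0// => i ij.
  by rewrite set_coordE (negbTE ij).
by have := sqnorm_ge0 x; have := sqr_ge0 t; nra.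
Qed.

(** A class closed under sums, products, rotations and partial integration, on which all the
    Gaussian integrals converge. The base [1 + sqnorm x] is at least 1, so exponents may be raised
    freely. *)
Definition tempered F := row_measurable F /\
  exists C K, 0 <= C /\ forall x, `|F x| <= C * (1 + sqnorm x) ^+ K.

Lemma tempered_cst (c : R) : tempered (fun _ => c).
Proof.
split; first exact: measurable_cst.
by exists `|c|, 0%N; split=> // x; rewrite expr0 mulr1.
Qed.

Lemma tempered_coord i : tempered (fun x => x ord0 i).
Proof.
split; first exact: row_measurable_coord.
exists 1, 1%N; split=> // x; rewrite mul1r expr1.
have : `|x ord0 i| ^+ 2 <= sqnorm x.
  rewrite real_normK ?num_real// /sqnorm (bigD1 i)//= lerDl.
  by apply: sumr_ge0 => k _; exact: sqr_ge0.
by have := sqr_ge0 (`|x ord0 i| - 1); nra.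
Qed.

Lemma temperedD F G : tempered F -> tempered G -> tempered (fun x => F x + G x).
Proof.
move=> [mF [C [K [C0 FC]]]] [mG [C' [K' [C'0 GC]]]]; split.
  exact: measurable_funD.
exists (C + C'), (K + K')%N; split; first exact: addr_ge0.
move=> x; rewrite (le_trans (ler_normD _ _))// mulrDl lerD//.
  rewrite (le_trans (FC x))// ler_wpM2l// ler_weXn2l ?leq_addr//.
  exact: sqnorm1_ge1.
rewrite (le_trans (GC x))// ler_wpM2l// ler_weXn2l ?leq_addl//.
exact: sqnorm1_ge1.
Qed.

Lemma temperedM F G : tempered F -> tempered G -> tempered (fun x => F x * G x).
Proof.
move=> [mF [C [K [C0 FC]]]] [mG [C' [K' [C'0 GC]]]]; split.
  exact: measurable_funM.
exists (C * C'), (K + K')%N; split; first exact: mulr_ge0.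
by move=> x; rewrite normrM exprD mulrACA ler_pM.
Qed.

Lemma temperedZ (c : R) F : tempered F -> tempered (fun x => c * F x).
Proof. exact: temperedM (tempered_cst c). Qed.

Lemma temperedN F : tempered F -> tempered (fun x => - F x).
Proof.
move=> tF; have -> : (fun x => - F x) = (fun x => -1 * F x).
  by apply/funext => x; rewrite mulN1r.
exact: temperedZ.
Qed.

Lemma tempered_sum (I : Type) (r : seq I) (f : I -> 'rV[R]_d -> R) :
  (forall k : I, tempered (f k)) -> tempered (fun x => \sum_(i <- r) f i x).
Proof.
move=> tf; elim: r => [|i r IH].
  by under eq_fun do rewrite big_nil; exact: tempered_cst.
by under eq_fun do rewrite big_cons; exact: temperedD.
Qed.

Lemma tempered_mulmx (A : 'M[R]_d) F : orthogonal_mx A -> tempered F ->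
  tempered (fun x => F (x *m A)).
Proof.
move=> oA [mF [C [K [C0 FC]]]]; split; first exact: row_measurable_mulmx.
by exists C, K; split=> // x; rewrite -(sqnorm_mulmx x oA).
Qed.

(** Taking the growth bound itself as [G] writes [F] as the difference of the nonnegative tempered
    functions [F + G] and [G]. *)
Lemma tempered_split F : tempered F -> exists G, [/\ tempered G,
  (forall x, 0 <= G x) & forall x, 0 <= F x + G x].
Proof.
move=> [mF [C [K [C0 FC]]]]; exists (fun x => C * (1 + sqnorm x) ^+ K); split.
- split.
    apply: measurable_funM; first exact: measurable_cst.
    apply: measurable_funX; apply: measurable_funD; first exact: measurable_cst.
    apply: measurable_sum => i; apply: measurable_funX.
    exact: measurable_row_of_tuple.
  exists C, K; split=> // x; rewrite ger0_norm// mulr_ge0// exprn_ge0//.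
  exact: sqnorm1_ge0.
- by move=> x; rewrite mulr_ge0// exprn_ge0// sqnorm1_ge0.
- by move=> x; have := FC x; rewrite ler_norml => /andP[+ _]; rewrite -subr_ge0 opprK.
Qed.

Lemma tempered_slice_bound F x j : tempered F ->
  exists C K, forall t, `|F (set_coord x j t)| <= C * (1 + t ^+ 2) ^+ K.
Proof.
move=> [_ [C [K [C0 FC]]]]; exists (C * (1 + sqnorm x) ^+ K), K => t.
rewrite (le_trans (FC _))// -mulrA ler_wpM2l// -exprMn lerXn2r ?nnegrE//.
- exact: sqnorm1_ge0.
- by rewrite mulr_ge0 ?sqnorm1_ge0// addr_ge0 ?sqr_ge0.
- exact: sqnorm1_set_coord.
Qed.

Lemma tempered_integrable F x j : tempered F ->
  mu.-integrable setT (EFin \o (fun t => phi t * F (set_coord x j t))).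
Proof.
move=> tF; have [C [K FC]] := tempered_slice_bound x j tF.
apply: (integrable_std_normal_mul _ FC).
exact: row_measurable_slice tF.1.
Qed.

(** Integrability makes the extended integral finite, so the real-valued integral is not a default
    value. *)
Lemma integ_coord_EFin F x j : tempered F ->
  (integ_coord gauss j F x)%:E = (\int[mu]_t (phi t * F (set_coord x j t))%:E)%E.
Proof.
by move=> tF; rewrite fineK//; apply: integrable_fin_num => //;
  exact: tempered_integrable.
Qed.

(** The positive and negative parts of the integrand have measurable partial integrals by Tonelli;
    the difference and [fine] preserve measurability. *)
Lemma row_measurable_integ_coord F j :
  row_measurable F -> row_measurable (integ_coord gauss j F).
Proof.
move=> mF.
pose f (ut : d.-tuple R * R) :=
  (phi ut.2 * F (set_coord (row_of_tuple ut.1) j ut.2))%:E.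
have mf : measurable_fun setT f.
  apply/measurable_EFinP; apply: measurable_funM.
    exact: (measurableT_comp (measurable_normal_pdf _ _)).
  exact: row_measurable_slice2.
apply: (measurableT_comp (@fine_measurable R _ measurableT)).
have -> : (fun u : d.-tuple R =>
      \int[mu]_t (phi t * F (set_coord (row_of_tuple u) j t))%:E)%E =
    (fun u => fubini_F mu f^\+%E u - fubini_F mu f^\-%E u)%E.
  apply/funext => u; rewrite integralE /fubini_F /=.
  by congr (_ - _)%E; apply: eq_integral => t _; rewrite ?funeposE ?funenegE.
apply: emeasurable_funB.
  apply: measurable_fun_fubini_tonelli_F => //; exact: measurable_funepos.
apply: measurable_fun_fubini_tonelli_F => //; exact: measurable_funeneg.
Qed.

(** The exponent [K] is kept, and the constant is multiplied by the Gaussian moment [M] of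
    [(1 + t^2)^K]. *)
Lemma tempered_integ_coord F j : tempered F -> tempered (integ_coord gauss j F).
Proof.
move=> tF; split; first by apply: row_measurable_integ_coord; exact: tF.1.
have [_ [C [K [C0 FC]]]] := tF.
pose M := \int[mu]_t (phi t * (1 + t ^+ 2) ^+ K).
have M0 : 0 <= M.
  apply: Rintegral_ge0 => t _; rewrite mulr_ge0 ?normal_pdf_ge0// exprn_ge0//.
  by rewrite addr_ge0 ?sqr_ge0.
exists (C * M), K; split; first exact: mulr_ge0.
move=> x; have iF := tempered_integrable x j tF.
rewrite (le_trans (le_normr_Rintegral _ iF))//.
rewrite mulrAC -RintegralZl//; last exact: integrable_std_normal_poly.
apply: le_Rintegral => //.
- exact: (integrable_norm iF).
- exact: (integrableZl measurableT _ (integrable_std_normal_poly K)).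
move=> t _; rewrite normrM (ger0_norm (normal_pdf_ge0 _ _ _)) mulrCA.
rewrite ler_wpM2l ?normal_pdf_ge0// (le_trans (FC _))// -mulrA ler_wpM2l//.
rewrite -exprMn lerXn2r ?nnegrE//.
- exact: sqnorm1_ge0.
- by rewrite mulr_ge0 ?sqnorm1_ge0// addr_ge0 ?sqr_ge0.
- exact: sqnorm1_set_coord.
Qed.

Lemma tempered_integ_coords F s : tempered F -> tempered (integ_coords gauss s F).
Proof. by move=> tF; elim: s => //= j s; exact: tempered_integ_coord. Qed.

Lemma integ_coordsD F G s : tempered F -> tempered G ->
  integ_coords gauss s (fun x => F x + G x) =
  fun x => integ_coords gauss s F x + integ_coords gauss s G x.
Proof.
move=> tF tG; elim: s => //= j s ->; apply/funext => x.
rewrite /integ_coord -RintegralD//; first by apply: eq_Rintegral => t _; rewrite mulrDr.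
  by apply: tempered_integrable; exact: tempered_integ_coords.
by apply: tempered_integrable; exact: tempered_integ_coords.
Qed.

Definition indep_of s (h : 'rV[R]_d -> R) :=
  forall j x t, j \in s -> h (set_coord x j t) = h x.

Lemma indep_of_integ_coords F s : indep_of s (integ_coords gauss s F).
Proof.
elim: s => // i s IH j x t; rewrite inE /= /integ_coord.
have [->|ij] /= := eqVneq j i.
  by move=> _; apply: eq_Rintegral => u _; rewrite set_coord_set_coord.
by move=> js; apply: eq_Rintegral => u _; rewrite set_coordC// IH.
Qed.

(** Along each integrated slice [h] is constant and leaves the integral by linearity. *)
Lemma integ_coords_indep_mul F h s : tempered F -> indep_of s h ->
  integ_coords gauss s (fun x => h x * F x) =
  fun x => h x * integ_coords gauss s F x.
Proof.
move=> tF; elim: s => //= j s IH hjs.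
have hs : indep_of s h by move=> k x t ks; apply: hjs; rewrite inE ks orbT.
rewrite IH//; apply/funext => x; rewrite /integ_coord -RintegralZl//.
  by apply: eq_Rintegral => t _; rewrite hjs ?mem_head// mulrCA.
by apply: tempered_integrable; exact: tempered_integ_coords.
Qed.

Lemma integ_coords_cst (c : R) s : integ_coords gauss s (fun _ => c) = fun _ => c.
Proof.
elim: s => //= j s ->; apply/funext => x; rewrite /integ_coord RintegralZr//.
  by rewrite /Rintegral integral_normal_pdf mul1r.
exact: integrable_normal_pdf.
Qed.

Lemma integ_coords_indep h s : indep_of s h -> integ_coords gauss s h = h.
Proof.
move=> hs; have := integ_coords_indep_mul (tempered_cst 1) hs.
rewrite integ_coords_cst; under [X in integ_coords _ _ X]eq_fun do rewrite mulr1.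
by move=> ->; apply/funext => x; rewrite mulr1.
Qed.

Lemma integ_coordsZ (c : R) F s : tempered F ->
  integ_coords gauss s (fun x => c * F x) = fun x => c * integ_coords gauss s F x.
Proof. by move=> tF; exact: (@integ_coords_indep_mul _ (fun _ => c)). Qed.

Lemma integ_coordsB F G s : tempered F -> tempered G ->
  integ_coords gauss s (fun x => F x - G x) =
  fun x => integ_coords gauss s F x - integ_coords gauss s G x.
Proof.
move=> tF tG.
have -> : (fun x => F x - G x) = (fun x => F x + -1 * G x).
  by apply/funext => x; rewrite mulN1r.
rewrite integ_coordsD ?integ_coordsZ//; last exact: temperedZ.
by apply/funext => x; rewrite mulN1r.
Qed.

Lemma integ_coords_sum (I : Type) (r : seq I) (f : I -> 'rV[R]_d -> R) s :
  (forall k : I, tempered (f k)) ->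
  integ_coords gauss s (fun x => \sum_(i <- r) f i x) =
  fun x => \sum_(i <- r) integ_coords gauss s (f i) x.
Proof.
move=> tf; elim: r => [|i r IH].
  under eq_fun do rewrite big_nil.
  by rewrite integ_coords_cst; apply/funext => x; rewrite big_nil.
under eq_fun do rewrite big_cons.
rewrite integ_coordsD ?IH//; last exact: tempered_sum.
by apply/funext => x; rewrite big_cons.
Qed.

Lemma integ_coords_ge0 F s : (forall x, 0 <= F x) ->
  forall x, 0 <= integ_coords gauss s F x.
Proof.
move=> F0; elim: s => //= j s IH x; apply: Rintegral_ge0 => t _.
by rewrite mulr_ge0 ?normal_pdf_ge0.
Qed.

(** The bridge between the two kinds of iterated integrals: each integration over a coordinate of
    [s] uses up its factor of the density, and the remaining coordinates keep theirs. *)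
Lemma int_coords_gauss F s x : uniq s -> tempered F ->
  int_coords s (fun y => (F y * prod_density gauss y)%:E) x =
  (integ_coords gauss s F x * \prod_(i | i \notin s) phi (x ord0 i))%:E.
Proof.
move=> + tF; elim: s x => [|j s IH] x /=; first by [].
move=> /andP[js us].
pose P := \prod_(i | i \notin j :: s) phi (x ord0 i).
have tG := tempered_integ_coords s tF.
rewrite -[X in (_ * X)%:E]/P EFinM integ_coord_EFin// muleC -integralZl//; last first.
  exact: tempered_integrable.
apply: eq_integral => t _; rewrite IH//; congr (_%:E).
rewrite (bigD1 j)//= set_coordE eqxx.
rewrite (eq_bigr (fun i => phi (x ord0 i))); last first.
  by move=> i /andP[_ ij]; rewrite set_coordE (negbTE ij).
rewrite (eq_bigl (fun i => i \notin j :: s)); last first.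
  by move=> i; rewrite inE negb_or andbC.
by rewrite -/P; ring.
Qed.

End tempered.

(** * Gaussian expectation: rotation invariance, conditioning, Bessel *)

Section gaussian_expectation.
Context {R : realType} {d : nat}.
Local Notation mu := (@lebesgue_measure R).
Local Notation phi := (@normal_pdf R 0 1).
Local Notation gauss := (@std_gauss_marg R d).
Local Notation E := (prod_exp gauss).
Implicit Types (F G : 'rV[R]_d -> R) (x : 'rV[R]_d) (i j : 'I_d).

Lemma prod_density_gaussE x :
  prod_density gauss x = normal_peak 1 ^+ d * expR (- sqnorm x / 2).
Proof.
rewrite /prod_density /std_gauss_marg; under eq_bigr do rewrite std_normal_pdfE.
rewrite big_split/= prodr_const card_ord -expR_sum; congr (_ * expR _).
by rewrite -mulr_suml sumrN.
Qed.

Lemma prod_density_gauss_gt0 x : 0 < prod_density gauss x.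
Proof. by apply: prodr_gt0 => i _; exact: std_normal_pdf_gt0. Qed.

Lemma prod_density_gauss_mulmx (A : 'M[R]_d) x : orthogonal_mx A ->
  prod_density gauss (x *m A) = prod_density gauss x.
Proof. by move=> oA; rewrite !prod_density_gaussE sqnorm_mulmx. Qed.

Lemma ge0_row_measurable_gauss F : tempered F -> (forall x, 0 <= F x) ->
  ge0_row_measurable (fun y => (F y * prod_density gauss y)%:E).
Proof.
move=> tF F0; split; last first.
  by move=> x; rewrite lee_fin mulr_ge0// ltW// prod_density_gauss_gt0.
apply/measurable_EFinP; apply: measurable_funM; first exact: tF.1.
apply: measurable_prod => i _.
apply: (measurableT_comp (measurable_normal_pdf _ _)).
exact: measurable_row_of_tuple.
Qed.

Lemma lint_gauss F : tempered F ->
  lint (fun y => (F y * prod_density gauss y)%:E) = (E F)%:E.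
Proof.
move=> tF; rewrite /lint int_coords_gauss ?enum_uniq// big_pred0 ?mulr1// => i.
by rewrite mem_enum.
Qed.

(** Through [tempered_split], identities between subtractive functionals need checking on
    nonnegative functions only, where Tonelli is available. *)
Lemma tempered_ext (T1 T2 : ('rV[R]_d -> R) -> R) :
  (forall F G, tempered F -> tempered G ->
     T1 (fun x => F x - G x) = T1 F - T1 G) ->
  (forall F G, tempered F -> tempered G ->
     T2 (fun x => F x - G x) = T2 F - T2 G) ->
  (forall F, tempered F -> (forall x, 0 <= F x) -> T1 F = T2 F) ->
  forall F, tempered F -> T1 F = T2 F.
Proof.
move=> T1B T2B T12 F tF; have [G [tG G0 FG0]] := tempered_split tF.
have -> : F = (fun x => (F x + G x) - G x) by apply/funext => x; rewrite addrK.
rewrite T1B ?T2B// ?T12//; exact: temperedD.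
Qed.

Lemma prod_exp_mulmx (A : 'M[R]_d) F : orthogonal_mx A -> tempered F ->
  E (fun x => F (x *m A)) = E F.
Proof.
move=> oA; have uA : A \in unitmx by have [] := mulmx1_unit oA.
have [c c0 Ac] := scales_lint_unitmx uA.
have cE G : tempered G -> (forall x, 0 <= G x) -> E (fun x => G (x *m A)) = c * E G.
  move=> tG G0; apply: EFin_inj; rewrite EFinM -!lint_gauss//; last exact: tempered_mulmx.
  rewrite -Ac; last exact: ge0_row_measurable_gauss.
  by under [in RHS]eq_fun do rewrite prod_density_gauss_mulmx//.
(* The constant function 1 has expectation 1 before and after rotation. *)
have c1 : c = 1.
  have := cE (fun _ => 1) (tempered_cst 1) (fun _ => ler01).
  by rewrite /prod_exp integ_coords_cst mulr1 => <-.
move: F; apply: (@tempered_ext (fun F => E (fun x => F (x *m A))) E) =>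
  [F G tF tG|F G tF tG|F tF F0].
- by rewrite /prod_exp (@integ_coordsB _ _ (fun x => F (x *m A)) (fun x => G (x *m A)))//;
    exact: tempered_mulmx.
- by rewrite /prod_exp integ_coordsB.
- by rewrite cE// c1 mul1r.
Qed.

(** Coordinate [i] can be integrated last: for nonnegative [F] the order is changed in the
    unweighted integral of [F] times the density. *)
Lemma prod_exp_coord i F : tempered F ->
  E F = integ_coord gauss i (prod_exp_except gauss i F) 0.
Proof.
have -> : integ_coord gauss i (prod_exp_except gauss i F) 0 =
  integ_coords gauss (i :: rem i (enum 'I_d)) F 0.
  by rewrite /prod_exp_except rem_filter ?enum_uniq.
set s := i :: _.
have us : uniq s by rewrite /= mem_rem_uniqF ?enum_uniq// rem_uniq ?enum_uniq.
move: F; apply: (@tempered_ext E (fun F => integ_coords gauss s F 0)) =>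
  [F G tF tG|F G tF tG|F tF F0].
- by rewrite /prod_exp integ_coordsB.
- by rewrite integ_coordsB.
have mFW := ge0_row_measurable_gauss tF F0.
apply: EFin_inj; rewrite -lint_gauss// /lint (int_coords_rem (j := i)) ?mem_enum//.
rewrite -int_coord_int_coords// -[int_coord i _]/(int_coords s _).
rewrite int_coords_gauss// big_pred0 ?mulr1// => j.
rewrite inE; have [//|ji] := eqVneq j i.
by rewrite mem_rem_uniq ?enum_uniq// !inE ji mem_enum.
Qed.

Definition only_coord i (h : 'rV[R]_d -> R) := indep_of [seq j <- enum 'I_d | j != i] h.

Lemma only_coord_coord i : only_coord i (fun x => x ord0 i).
Proof.
by move=> j x t; rewrite mem_filter => /andP[ji _]; rewrite set_coordE eq_sym (negbTE ji).
Qed.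

Lemma only_coord_prod_exp_except i F : only_coord i (prod_exp_except gauss i F).
Proof. exact: indep_of_integ_coords. Qed.

Lemma tempered_prod_exp_except i F : tempered F -> tempered (prod_exp_except gauss i F).
Proof. exact: tempered_integ_coords. Qed.

Lemma prod_exp_except_mul i h F : only_coord i h -> tempered F ->
  prod_exp_except gauss i (fun x => h x * F x) =
  fun x => h x * prod_exp_except gauss i F x.
Proof. by move=> hi tF; exact: integ_coords_indep_mul. Qed.

(** The tower property of conditional expectation given [x_i]: once the other coordinates are
    integrated out, both sides have the same integrand in [x_i]. *)
Lemma prod_exp_except_tower i h F : only_coord i h -> tempered h -> tempered F ->
  E (fun x => h x * prod_exp_except gauss i F x) = E (fun x => h x * F x).
Proof.
move=> hi th tF; have tg := tempered_prod_exp_except i tF.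
rewrite !(@prod_exp_coord i); [|exact: temperedM..].
rewrite !prod_exp_except_mul//; congr (integ_coord _ _ _ _).
apply/funext => x; congr (_ * _).
by rewrite [LHS]/prod_exp_except integ_coords_indep//; exact: only_coord_prod_exp_except.
Qed.

(** If [j] lies in the tail, the inner integral is already 0; if not, the tail leaves [x_j]
    unchanged and the outer integral is the mean of the normal law. *)
Lemma integ_coords_coord0 j (s : seq 'I_d) : j \in s ->
  integ_coords gauss s (fun x => x ord0 j) = fun _ => 0.
Proof.
elim: s => //= k s IH; rewrite inE; have [js|js] := boolP (j \in s).
  by rewrite IH// => _; exact: (integ_coords_cst 0 [:: k]).
rewrite orbF => /eqP <-; rewrite integ_coords_indep; last first.
  move=> i x t is_; rewrite set_coordE; case: eqP => // ji.
  by move: js; rewrite ji is_.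
apply/funext => x; rewrite /integ_coord -[RHS]std_normal_mean.
by apply: eq_Rintegral => t _; rewrite set_coordE eqxx.
Qed.

Lemma prod_exp_except_coord i j :
  prod_exp_except gauss i (fun x => x ord0 j) = fun x => (j == i)%:R * x ord0 j.
Proof.
have [->|ji] := eqVneq j i.
  rewrite /prod_exp_except integ_coords_indep; last exact: only_coord_coord.
  by apply/funext => x; rewrite mul1r.
rewrite /prod_exp_except integ_coords_coord0; first by apply/funext => x; rewrite mul0r.
by rewrite mem_filter ji mem_enum.
Qed.

Lemma prod_exp_coord_coord i j : E (fun x => x ord0 i * x ord0 j) = (i == j)%:R.
Proof.
have ti := @tempered_coord R d i; have tj := @tempered_coord R d j.
rewrite (@prod_exp_coord i); last exact: temperedM.
rewrite (@prod_exp_except_mul i (fun x => x ord0 i))//; last exact: only_coord_coord.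
rewrite prod_exp_except_coord; have [<-|ij] := eqVneq j i.
  rewrite /integ_coord -[RHS]std_normal_second_moment.
  by apply: eq_Rintegral => t _; rewrite set_coordE eqxx mul1r expr2.
rewrite -[RHS](congr1 (fun f => f 0) (integ_coords_cst 0 [:: i])).
by rewrite /=; congr (integ_coord _ _ _ _); apply/funext => x; rewrite mul0r mulr0.
Qed.

(* Bessel's inequality for the first Hermite polynomial [x_i]. *)
Lemma prod_exp_sqr_ge i F : tempered F ->
  (E (fun x => x ord0 i * F x)) ^+ 2 <= E (fun x => F x ^+ 2).
Proof.
move=> tF; set a := E _.
have ti := @tempered_coord R d i.
have tF2 : tempered (fun x => F x ^+ 2) by exact: (temperedM tF tF).
have tiF := temperedM ti tF; have tii := temperedM ti ti.
have : 0 <= E (fun x => (F x - a * x ord0 i) ^+ 2).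
  by apply: integ_coords_ge0 => x; exact: sqr_ge0.
have -> : (fun x => (F x - a * x ord0 i) ^+ 2) =
  (fun x => F x ^+ 2 + ((- 2 * a) * (x ord0 i * F x) + a ^+ 2 * (x ord0 i * x ord0 i))).
  by apply/funext => x; ring.
rewrite {1}/prod_exp integ_coordsD//; last by apply: temperedD; exact: temperedZ.
rewrite (@integ_coordsD _ _ (fun x => - 2 * a * (x ord0 i * F x))); [|exact: temperedZ..].
rewrite !integ_coordsZ// -[X in _ + (_ * X + _)]/a.
rewrite -[X in _ + (_ + _ * X)]/(E (fun x => x ord0 i * x ord0 i)).
rewrite prod_exp_coord_coord eqxx -[X in 0 <= X + _]/(E (fun x => F x ^+ 2)).
rewrite mulr1 -[a ^+ 2 <= _]subr_ge0; congr (0 <= _); ring.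
Qed.

End gaussian_expectation.

(** * Logarithmic derivatives and their growth *)

Section log_derivatives.
Context {R : realType} {d : nat}.
Implicit Types (p : 'rV[R]_d -> R) (x y v : 'rV[R]_d) (i j k : 'I_d).

(** For [h != 0] the difference quotient is exactly [a + h * b]. This serves for Gaussian
    log-densities, which are quadratic along every line. *)
Lemma derive_quadratic (f : 'rV[R]_d -> R) x v (a b : R) :
  (forall h, f (h *: v + x) = f x + h * a + h ^+ 2 * b) -> 'D_v f x = a.
Proof.
move=> fE; apply: cvg_lim => //.
apply: (@cvg_trans _ ((a + h * b) @[h --> (0 : R)^'])).
  apply: near_eq_cvg; near=> h.
  have h0 : h != 0 by near: h; exact: nbhs_dnbhs_neq.
  rewrite /= fE /GRing.scale /=; field.
  exact: h0.
have -> : a = a + 0 * b by rewrite mul0r addr0.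
apply: cvg_within_filter.
apply: cvgD; first by rewrite mul0r addr0; exact: cvg_cst.
by apply: cvgM; [exact: cvg_id|exact: cvg_cst].
Unshelve. all: by end_near. Qed.

Lemma dlog_gauss i x : dlog i (prod_density (@std_gauss_marg R d)) x = - x ord0 i.
Proof.
apply: (@derive_quadratic _ _ _ _ (- 2^-1)) => h.
rewrite !prod_density_gaussE.
rewrite !lnM ?posrE ?expR_gt0 ?exprn_gt0 ?normal_peak_gt0 ?oner_eq0//.
rewrite !expRK -!addrA; congr (_ + _).
have -> : sqnorm (h *: ebasis R i + x) = sqnorm x + 2 * h * x ord0 i + h ^+ 2.
  rewrite /sqnorm (bigD1 i)//= [in RHS](bigD1 i)//= !mxE !eqxx mulr1.
  rewrite (eq_bigr (fun k => x ord0 k ^+ 2)) => [|k ki]; first by ring.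
  by rewrite !mxE (negbTE ki) andbF mulr0 add0r.
by field.
Qed.

Lemma dlog_gauss_density (S : 'M[R]_d) i x : S^T = S ->
  (forall y, 0 < gauss_density S y) ->
  dlog i (gauss_density S) x = - (x *m invmx S) ord0 i.
Proof.
move=> Ssym pos; set M := invmx S.
have Msym : M^T = M by rewrite trmx_inv Ssym.
pose N := (Num.sqrt ((pi *+ 2) ^+ d * \det S))^-1.
(* Square roots of negative numbers and the inverse of 0 are 0 by convention; positivity of the
   density excludes these cases. *)
have N0 : 0 < N by have := pos x; rewrite pmulr_rgt0// expR_gt0.
apply: (@derive_quadratic _ _ _ _ (- M i i / 2)) => h.
rewrite /gauss_density -/N -/M !lnM ?posrE ?expR_gt0// !expRK.
have -> : (h *: ebasis R i + x) *m M *m (h *: ebasis R i + x)^T =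
    x *m M *m x^T + (2 * h) *: (x *m M *m (ebasis R i)^T)
    + h ^+ 2 *: (ebasis R i *m M *m (ebasis R i)^T).
  (* Symmetry of [M] merges the two cross terms. *)
  have sw : ebasis R i *m M *m x^T = x *m M *m (ebasis R i)^T.
    rewrite -[LHS]trmxK [X in X^T = _](_ : _ = x *m M *m (ebasis R i)^T).
      by apply/matrixP => a b; rewrite !ord1 mxE.
    by rewrite !trmx_mul trmxK Msym mulmxA.
  rewrite linearD linearZ /= !mulmxDl !mulmxDr -!scalemxAl -!scalemxAr sw.
  move: (x *m M *m x^T) (x *m M *m _) (ebasis R i *m M *m _) => X Y Z.
  by apply/matrixP => a b; rewrite !mxE; ring.
have e1 (y : 'rV[R]_d) : (y *m (ebasis R i)^T) ord0 ord0 = y ord0 i.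
  by rewrite /ebasis trmx_delta -colE mxE.
have e2 : (ebasis R i *m M) ord0 i = M i i by rewrite /ebasis -rowE mxE.
have entry (X Y Z : 'M[R]_1) (a b : R) : (X + a *: Y + b *: Z) ord0 ord0 =
    X ord0 ord0 + a * Y ord0 ord0 + b * Z ord0 ord0 by rewrite !mxE.
by rewrite entry !e1 e2; field.
Qed.

Section differentiable_density.
Variable p : 'rV[R]_d -> R.
Hypotheses (p_gt0 : forall x, 0 < p x) (dp : forall x, differentiable p x).

Lemma differentiable_ln_density x : differentiable (@ln R \o p) x.
Proof.
apply: differentiable_comp => //; apply/derivable1_diffP.
by have [] := is_derive1_ln (p_gt0 x).
Qed.

(** This form shows that [dlog k p] is continuous, hence measurable, when the partial derivatives of
    [p] are continuous. *)
Lemma dlogE k x : dlog k p x = (p x)^-1 * partial k p x.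
Proof.
have dln : differentiable (@ln R) (p x).
  by apply/derivable1_diffP; have [] := is_derive1_ln (p_gt0 x).
rewrite /dlog /partial -[fun y => ln (p y)]/(@ln R \o p) !deriveE//; last first.
  exact: differentiable_ln_density.
rewrite diff_comp//= diff1E// derive1E.
by have [_ ->] := is_derive1_ln (p_gt0 x); rewrite mulrC.
Qed.

(** Moving [x] along [e_i] moves [x *m A] along row [i] of [A]; linearity of the differential
    expands that direction in the basis. *)
Lemma dlog_rot_density (A : 'M[R]_d) i x :
  dlog i (rot_density A p) x = \sum_k A i k * dlog k p (x *m A).
Proof.
rewrite /dlog /partial /rot_density.
have -> : 'D_(ebasis R i) (fun y => ln (p (y *m A))) x =
    'D_(ebasis R i *m A) (@ln R \o p) (x *m A).
  apply: (congr1 (fun g : R -> R => lim (g @ (0 : R)^'))); apply/funext => h /=.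
  by rewrite mulmxDl -scalemxAl.
rewrite deriveE; last exact: differentiable_ln_density.
rewrite -rowE (row_sum_delta (row i A)) linear_sum; apply: eq_bigr => k _.
rewrite linearZ /= mxE; congr (_ * _).
rewrite -[fun y => ln (p y)]/(@ln R \o p) deriveE//.
exact: differentiable_ln_density.
Qed.

End differentiable_density.

(** The real exponent [m] is rounded up to a natural one, after the base has been enlarged to
    [1 + sqnorm x], which is at least 1. *)
Lemma powR_norm2_le x (m : R) : 0 <= m ->
  powR (norm2 x) m <= (1 + sqnorm x) ^+ (Num.truncn m).+1.
Proof.
move=> m0; have s0 := sqnorm_ge0 x.
have n1 : norm2 x <= 1 + sqnorm x.
  have := sqr_ge0 (norm2 x - 1); have : norm2 x ^+ 2 = sqnorm x by rewrite sqr_sqrtr.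
  by nra.
rewrite -powR_mulrn ?sqnorm1_ge0//.
apply: (@le_trans _ _ (powR (1 + sqnorm x) m)).
  by apply: ge0_ler_powR; rewrite ?nnegrE ?sqrtr_ge0 ?sqnorm1_ge0.
apply: ler_powR; first exact: sqnorm1_ge1.
exact/ltW/truncnS_gt.
Qed.

Lemma tempered_dlog p k : standing_assumptions p -> tempered (dlog k p).
Proof.
move=> [p0 _ [dp cp] [c [m [c0 m2 _ gradp]]]]; split.
  apply: continuous_row_measurable => x.
  have -> : dlog k p = (fun y => (p y)^-1 * partial k p y).
    by apply/funext => y; rewrite dlogE.
  apply: (@continuousM _ _ (fun y => (p y)^-1)); last exact: cp.
  apply: continuousV; first by rewrite gt_eqF.
  exact: differentiable_continuous.
(* Both terms of [1 + powR (norm2 x) m] are at most the same power of [1 + sqnorm x], whence the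
   factor 2. *)
exists (c * 2), (Num.truncn m).+1; split; first by rewrite mulr_ge0// ltW.
move=> x; apply: (@le_trans _ _ (Num.sqrt (\sum_(i < d) dlog i p x ^+ 2))).
  rewrite -sqrtr_sqr ler_sqrt; last by apply: sumr_ge0 => i _; exact: sqr_ge0.
  by rewrite (bigD1 k)//= lerDl; apply: sumr_ge0 => i _; exact: sqr_ge0.
rewrite (le_trans (gradp x))// -mulrA ler_pM2l// mulr_natl mulr2n lerD//.
  by rewrite exprn_ege1// sqnorm1_ge1.
by apply: powR_norm2_le; rewrite (le_trans _ m2).
Qed.

End log_derivatives.

(** * The lower bound and the Gaussian equality case *)

Section projected_fisher.
Context {R : realType} {d : nat}.
Local Notation gauss := (@std_gauss_marg R d).
Local Notation E := (prod_exp gauss).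
Variable p : 'rV[R]_d -> R.
Hypothesis pP : standing_assumptions p.

Lemma dlog_diffE (A : 'M[R]_d) i :
  (fun y => dlog i (prod_density gauss) y - dlog i (rot_density A p) y) =
  (fun y => - (y ord0 i + \sum_k A i k * dlog k p (y *m A))).
Proof.
have [p0 _ [dp _] _] := pP.
by apply/funext => y; rewrite dlog_gauss dlog_rot_density// opprD.
Qed.

Lemma tempered_dlog_diff (A : 'M[R]_d) i : orthogonal_mx A ->
  tempered (fun y => dlog i (prod_density gauss) y - dlog i (rot_density A p) y).
Proof.
move=> oA; rewrite dlog_diffE; apply: temperedN; apply: temperedD.
  exact: tempered_coord.
apply: tempered_sum => k; apply: temperedZ; apply: tempered_mulmx => //.
exact: tempered_dlog.
Qed.

(** As a function of [y *m A], the integrand is a combination of the integrands [h j k] that define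
    the entries of [Hmat p]; rotation invariance then removes [A] from the argument. *)
Lemma prod_exp_coord_dlog_diff (A : 'M[R]_d) i : orthogonal_mx A ->
  E (fun y => y ord0 i *
    (dlog i (prod_density gauss) y - dlog i (rot_density A p) y)) =
  - (A *m Hmat p *m A^T) i i.
Proof.
move=> oA.
pose h j k (y : 'rV[R]_d) := y ord0 j * (dlog k p y + y ord0 k).
have th j k : tempered (h j k).
  apply: temperedM; first exact: tempered_coord.
  by apply: temperedD; [exact: tempered_dlog|exact: tempered_coord].
pose f (y : 'rV[R]_d) := \sum_k \sum_j (- (A i j * A i k)) * h j k y.
have tf : tempered f.
  by apply: tempered_sum => k; apply: tempered_sum => j; exact: temperedZ.
have -> : (fun y : 'rV[R]_d => y ord0 i *
      (dlog i (prod_density gauss) y - dlog i (rot_density A p) y)) = (fun y => f (y *m A)).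
  have /funeqP dE := dlog_diffE A i.
  apply/funext => y; rewrite dE /f.
  (* Orthogonality recovers [y] from [y *m A]; this is applied both to the factor [y_i] and to the
     term [y_i] inside the score difference. *)
  have yE j : y ord0 j = \sum_k (y *m A) ord0 k * A j k.
    rewrite -[in LHS](mulmx1 y) -oA mulmxA mxE.
    by apply: eq_bigr => k _; rewrite [A^T _ _]mxE.
  transitivity (- (\sum_j (y *m A) ord0 j * A i j *
     (\sum_k (dlog k p (y *m A) + (y *m A) ord0 k) * A i k))).
    rewrite -mulr_suml -yE mulrN; congr (- (_ * _)).
    rewrite [in LHS]yE -big_split /=; apply: eq_bigr => k _.
    by rewrite addrC mulrDl mulrC.
  rewrite exchange_big /= -sumrN; apply: eq_bigr => j _.
  rewrite mulr_sumr -sumrN; apply: eq_bigr => k _.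
  by rewrite /h; ring.
rewrite prod_exp_mulmx// /f /prod_exp.
rewrite integ_coords_sum; last by move=> k; apply: tempered_sum => j; exact: temperedZ.
rewrite mxE -sumrN; apply: eq_bigr => k _.
rewrite integ_coords_sum; last by move=> j; exact: temperedZ.
rewrite !mxE mulr_suml -sumrN; apply: eq_bigr => j _.
rewrite integ_coordsZ// mxE mulNr; congr (- _).
by rewrite -[X in _ * X]/(E (h j k)) mulrAC.
Qed.

Lemma proj_fisher_ge (A : 'M[R]_d) : orthogonal_mx A ->
  \sum_(i < d) ((A *m Hmat p *m A^T) i i) ^+ 2 <= proj_fisher gauss (rot_density A p).
Proof.
move=> oA; apply: ler_sum => i _.
have tf := tempered_dlog_diff i oA.
rewrite -sqrrN -prod_exp_coord_dlog_diff//.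
(* The tower property puts the projected score difference in place of the full one, so that Bessel
   bounds the projected quantity. *)
rewrite -(prod_exp_except_tower (@only_coord_coord R d i) (@tempered_coord R d i) tf).
by apply: prod_exp_sqr_ge; exact: tempered_prod_exp_except.
Qed.

Section gaussian_density.
Variable S : 'M[R]_d.
Hypotheses (Spos : posdef S) (pS : p = gauss_density S).

Lemma dlog_gaussian k x : dlog k p x = - \sum_j x ord0 j * invmx S j k.
Proof.
have [p0 _ _ _] := pP; rewrite pS in p0 *.
by rewrite dlog_gauss_density ?Spos.1// mxE.
Qed.

(** Here [dlog j p x + x_j] is the linear form given by column [j] of [1%:M - invmx S], and the
    covariance [E[x_i x_k]] is the identity matrix. *)
Lemma Hmat_gaussian : Hmat p = 1%:M - invmx S.
Proof.
apply/matrixP => i j; rewrite !mxE.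
have -> : (fun x : 'rV[R]_d => x ord0 i * (dlog j p x + x ord0 j)) =
  (fun x => \sum_k ((k == j)%:R - invmx S k j) * (x ord0 i * x ord0 k)).
  apply/funext => x; rewrite dlog_gaussian.
  under [RHS]eq_bigr do rewrite mulrBl.
  rewrite [RHS]sumrB [X in _ = X - _](bigD1 j)//= eqxx mul1r.
  rewrite [X in _ = _ + X - _]big1 ?addr0 => [|k kj]; last first.
    by rewrite (negbTE kj) mul0r.
  rewrite addrC mulrBr mulr_sumr; congr (_ - _).
  by apply: eq_bigr => k _; ring.
have tik k : tempered (fun x : 'rV[R]_d => x ord0 i * x ord0 k).
  by apply: temperedM; exact: tempered_coord.
rewrite /prod_exp integ_coords_sum; last by move=> k; exact: temperedZ.
under eq_bigr => k _.
  rewrite integ_coordsZ// -[X in _ * X]/(E (fun x => x ord0 i * x ord0 k)).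
  rewrite prod_exp_coord_coord; over.
rewrite (bigD1 i)//= eqxx mulr1 big1 ?addr0// => k ki.
by rewrite [i == k]eq_sym (negbTE ki) mulr0.
Qed.

Lemma proj_fisher_gaussian (A : 'M[R]_d) : orthogonal_mx A ->
  proj_fisher gauss (rot_density A p) = \sum_(i < d) ((A *m Hmat p *m A^T) i i) ^+ 2.
Proof.
move=> oA; apply: eq_bigr => i _; rewrite Hmat_gaussian.
pose N := A *m (1%:M - invmx S) *m A^T.
(* The score difference is linear in [y] with coefficients from column [i] of [- N]; the projection
   then kills every term except the one in [y_i]. *)
have fE : (fun y => dlog i (prod_density gauss) y - dlog i (rot_density A p) y) =
    (fun y => \sum_j (- N j i) * y ord0 j).
  rewrite dlog_diffE; apply/funext => y.
  transitivity (- (y *m N) ord0 i); last first.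
    by rewrite mxE -sumrN; apply: eq_bigr => j _; rewrite mulNr mulrC.
  congr (- _); rewrite /N mulmxBr mulmx1 mulmxBl oA mulmxBr mulmx1 2![in RHS]mxE.
  congr (_ + _); rewrite !mulmxA mxE -sumrN; apply: eq_bigr => k _.
  by rewrite dlog_gaussian mulrN mxE [in RHS]mxE mulrC.
rewrite fE -/N.
have -> : prod_exp_except gauss i (fun y => \sum_j - N j i * y ord0 j) =
    (fun y => - N i i * y ord0 i).
  rewrite /prod_exp_except integ_coords_sum; last first.
    by move=> j; apply: temperedZ; exact: tempered_coord.
  apply/funext => y; rewrite (bigD1 i)//= big1 ?addr0 => [|j ji].
    rewrite integ_coordsZ; last exact: tempered_coord.
    rewrite -[integ_coords _ _ _]/(prod_exp_except gauss i _).
    by rewrite prod_exp_except_coord eqxx mul1r.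
  rewrite integ_coordsZ; last exact: tempered_coord.
  rewrite -[integ_coords _ _ _]/(prod_exp_except gauss i _).
  by rewrite prod_exp_except_coord (negbTE ji) mul0r mulr0.
have -> : (fun y : 'rV[R]_d => (- N i i * y ord0 i) ^+ 2) =
    (fun y => N i i ^+ 2 * (y ord0 i * y ord0 i)).
  by apply/funext => y; ring.
rewrite /prod_exp integ_coordsZ; last by apply: temperedM; exact: tempered_coord.
rewrite -[X in _ * X]/(E (fun y => y ord0 i * y ord0 i)) prod_exp_coord_coord eqxx.
by rewrite mulr1.
Qed.

End gaussian_density.

End projected_fisher.

Theorem theorem3 (R : realType) (d : nat) (p : 'rV[R]_d -> R) :
  standing_assumptions p ->
  (forall Rm : 'M[R]_d, orthogonal_mx Rm ->
     proj_fisher (@std_gauss_marg R d) (rot_density Rm p)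
       >= \sum_(i < d) ((Rm *m Hmat p *m Rm^T) i i) ^+ 2) /\
  (forall S : 'M[R]_d, posdef S -> p = gauss_density S ->
     (forall Rm : 'M[R]_d, orthogonal_mx Rm ->
        proj_fisher (@std_gauss_marg R d) (rot_density Rm p)
          = \sum_(i < d) ((Rm *m Hmat p *m Rm^T) i i) ^+ 2) /\
     Hmat p = 1%:M - invmx S).
Proof.
move=> pP; split=> [Rm oR|S posS pS]; first exact: proj_fisher_ge.
split=> [Rm oR|]; first exact: (proj_fisher_gaussian pP posS pS).
exact: (Hmat_gaussian pP posS pS).
Qed.
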